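(* Let $\mathcal{G}=(X,E)$ be a $d$-uniform hypergraph on $n$ vertices with $d$-dimensional adjacency matrix $\mathbb{A}$, and let $P$ be the color matrix of a coloring $f$ of $\mathcal{G}$ into $k$ colors. Then $f$ is perfect if and only if there exists a $d$-dimensional matrix $\mathbb{S}$ of order $k$ such that $\mathbb{A}\circ P=P\circ\mathbb{S}$. Moreover, in this case the entries of $\mathbb{S}$ are $$s_\gamma=v_{\gamma_1,\gamma}\cdot\binom{d-1}{d_1,\dots,d_k}^{-1},\qquad \gamma=(\gamma_1,\dots,\gamma_d)\in[k]^d.$$ Here $v_{\gamma_1,\gamma}$ is the number of hyperedges whose color range is the multiset $\{\gamma_1,\dots,\gamma_d\}$ and which contain a given vertex of color $\gamma_1$ (this number does not depend on the chosen vertex), $d_l$ is the number of times the color $l$ occurs in the multiset $\{\gamma_2,\dots,\gamma_d\}$, and $\binom{d-1}{d_1,\dots,d_k}$ is the multinomial coefficient.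
   Context: A $d$-uniform hypergraph has a finite vertex set, identified with $[n]=\{1,\dots,n\}$, and hyperedges that are $d$-element subsets of it. Its adjacency matrix $\mathbb{A}$ is the $d$-dimensional array $(a_\alpha)_{\alpha\in[n]^d}$ with $a_{(x_1,\dots,x_d)}=1/(d-1)!$ if $\{x_1,\dots,x_d\}$ is a hyperedge (so the $x_i$ are distinct), and $a_{(x_1,\dots,x_d)}=0$ otherwise. Product $\circ$: let $\mathbb{A}$ be a $d$-dimensional array indexed by $[n]\times[p]^{d-1}$ and $\mathbb{B}$ a $t$-dimensional array indexed by $[p]\times[q]^{t-1}$ (ordinary matrices are $2$-dimensional arrays, vectors are $1$-dimensional). Then $\mathbb{A}\circ\mathbb{B}$ is the $((d-1)(t-1)+1)$-dimensional array with entries $$c_{i,\beta^2,\dots,\beta^d}=\sum_{i_2,\dots,i_d\in[p]}a_{i,i_2,\dots,i_d}\,b_{i_2,\beta^2}\cdots b_{i_d,\beta^d},\qquad \beta^j\in[q]^{t-1}.$$ In particular, for an $n\times k$ matrix $P$ and a $d$-dimensional $\mathbb{S}$ of order $k$, $(P\circ\mathbb{S})_{x,\beta}=\sum_{i}p_{x,i}s_{i,\beta}$. A coloring is a surjective map $f:[n]\to[k]$. Its color matrix $P$ is $n\times k$ with $p_{x,i}=1$ if $f(x)=i$ and $0$ otherwise. The color range of a hyperedge $e$ is the multiset $\{f(x):x\in e\}$. The coloring $f$ is perfect if, for each color $i$ and each multiset $\gamma$, all vertices of color $i$ lie in the same number of hyperedges of color range $\gamma$. *)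

(* Defs.v *)
From HB Require Import structures.
From mathcomp Require Import all_boot all_order all_algebra.
From mathcomp Require Import finmap multiset.

Set Implicit Arguments.
Unset Strict Implicit.
Unset Printing Implicit Defensive.

Import GRing.Theory.
Local Open Scope ring_scope.

Record uhypergraph (d n : nat) := UHypergraph {
  hyperedges :> {set {set 'I_n}};
  hyperedges_uniform : forall e, e \in hyperedges -> #|e| = d
}.

(* d-dimensional arrays indexed by [n] x [p]^(d-1). Only dimensions d >= 1 are
   meaningful: because of d.-1, dimension 0 has the same index set as
   dimension 1. *)
Definition array (R : Type) (d n p : nat) : Type :=
  {ffun 'I_n * (d.-1).-tuple 'I_p -> R}.

Definition cast_array (R : Type) (d d' n p : nat) (e : d = d')
    (A : array R d n p) : array R d' n p :=
  [ffun c : 'I_n * (d'.-1).-tuple 'I_p =>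
     A (c.1, tcast (congr1 predn (esym e)) c.2)].

Fact block_index_subproof (a b : nat) (j : 'I_a) (l : 'I_b) :
  (j * b + l < a * b)%N.
Proof.
apply: (@leq_trans (j.+1 * b)%N); last by rewrite leq_mul2r ltn_ord orbT.
by rewrite mulSn addnC ltn_add2r.
Qed.

Definition block_index (a b : nat) (j : 'I_a) (l : 'I_b) : 'I_(a * b) :=
  Ordinal (block_index_subproof j l).

(* The j-th of the a consecutive blocks of length b of an index beta. *)
Definition block (T : Type) (a b : nat) (beta : (a * b).-tuple T) (j : 'I_a) :
    b.-tuple T :=
  [tuple tnth beta (block_index j l) | l < b].

Definition array_prod (R : pzSemiRingType) (d t n p q : nat)
    (A : array R d n p) (B : array R t p q) :
    array R (d.-1 * t.-1).+1 n q :=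
  [ffun c : 'I_n * (d.-1 * t.-1).-tuple 'I_q =>
     \sum_(i : (d.-1).-tuple 'I_p)
        A (c.1, i) * \prod_(j < d.-1) B (tnth i j, block c.2 j)].

Definition array_of_mx (R : Type) (n p : nat) (M : 'M[R]_(n, p)) :
    array R 2 n p :=
  [ffun c : 'I_n * 1.-tuple 'I_p => M c.1 (thead c.2)].

Fact array_prod_mxr_dim (d : nat) : (0 < d)%N -> (d.-1 * 2.-1).+1 = d.
Proof. by case: d => // d _; rewrite muln1. Qed.

Fact array_prod_mxl_dim (d : nat) : (0 < d)%N -> (2.-1 * d.-1).+1 = d.
Proof. by case: d => // d _; rewrite mul1n. Qed.

(* A o M and M o S for d-dimensional A, S and a matrix M. They have dimensions
   (d-1)*1+1 and 1*(d-1)+1, both cast to d. *)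
Definition array_mulmx (R : pzSemiRingType) (d n p q : nat) (d_gt0 : (0 < d)%N)
    (A : array R d n p) (M : 'M[R]_(p, q)) : array R d n q :=
  cast_array (array_prod_mxr_dim d_gt0) (array_prod A (array_of_mx M)).

Definition mx_mularray (R : pzSemiRingType) (d n p q : nat) (d_gt0 : (0 < d)%N)
    (M : 'M[R]_(n, p)) (S : array R d p q) : array R d n q :=
  cast_array (array_prod_mxl_dim d_gt0) (array_prod (array_of_mx M) S).

(* A hyperedge has d elements, so {x_1, ..., x_d} \in G forces the x_i to be
   distinct. *)
Definition adjacency (R : unitRingType) (d n : nat) (G : uhypergraph d n) :
    array R d n n :=
  [ffun c : 'I_n * (d.-1).-tuple 'I_n =>
     if [set x in c.1 :: c.2] \in hyperedges G
     then ((d.-1)`!%:R)^-1 else 0].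

Definition coloring (n k : nat) (f : 'I_n -> 'I_k) : Prop :=
  forall i, exists x, f x = i.

Definition color_mx (R : pzSemiRingType) (n k : nat) (f : 'I_n -> 'I_k) :
    'M[R]_(n, k) :=
  \matrix_(x, i) (f x == i)%:R.

Definition color_range (n k : nat) (f : 'I_n -> 'I_k) (e : {set 'I_n}) :
    {mset 'I_k}%mset :=
  seq_mset [seq f x | x in e].

Definition range_degree (d n k : nat) (G : uhypergraph d n) (f : 'I_n -> 'I_k)
    (x : 'I_n) (gamma : {mset 'I_k}%mset) : nat :=
  #|[set e in hyperedges G | (x \in e) && (color_range f e == gamma)]|.

Definition perfect (d n k : nat) (G : uhypergraph d n) (f : 'I_n -> 'I_k) :
    Prop :=
  forall (i : 'I_k) (gamma : {mset 'I_k}%mset) (x y : 'I_n),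
    f x = i -> f y = i -> range_degree G f x gamma = range_degree G f y gamma.

(* The division is exact when m is the sum of the m_ l. *)
Definition multinomial (k m : nat) (m_ : 'I_k -> nat) : nat :=
  (m`! %/ \prod_(l < k) (m_ l)`!)%N.

(* Main.v *)
(** For a vertex [x] and colors [b] of length [d - 1], the entry of A o P at
    [(x, b)] is [1 / (d - 1)!] times the number of tuples [t] with [f t = b]
    such that [x :: t] enumerates a hyperedge, while the entry of P o S is
    [S (f x, b)]. A hyperedge [e] through [x] is enumerated by such a tuple
    exactly when its color range is that of [f x :: b], and then in
    [d_1! ... d_k!] ways, since the rest of [e] may be permuted inside each
    color class. Hence the entry of A o P is the range degree of [x] divided by
    the multinomial coefficient, and A o P = P o S says that this degree depends
    only on [f x]. Multisets that are not of the form [f x :: b] are harmless,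
    because their range degree at [x] is zero. *)

Require Import Defs.
From mathcomp Require Import all_boot all_order all_algebra.
From mathcomp Require Import finmap multiset.

Set Implicit Arguments.
Unset Strict Implicit.
Unset Printing Implicit Defensive.

Import GRing.Theory Num.Theory.
Local Open Scope ring_scope.

Lemma big_tuple_cons (R : Type) (idx : R) (op : Monoid.com_law idx)
    (T : finType) (m : nat) (P : pred (m.+1.-tuple T))
    (F : m.+1.-tuple T -> R) :
  \big[op/idx]_(t | P t) F t =
  \big[op/idx]_y \big[op/idx]_(t : m.-tuple T | P [tuple of y :: t])
    F [tuple of y :: t].
Proof.
rewrite pair_big_dep.
rewrite (reindex (fun p : T * m.-tuple T => [tuple of p.1 :: p.2])) //.
exists (fun t => (thead t, [tuple of behead t])) => [[y t] _|t _] /=.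
  by congr pair; apply: val_inj.
by rewrite [RHS]tuple_eta.
Qed.

Lemma eq_set_seq_perm_enum (T : finType) (s : seq T) (e : {set T}) :
  size s = #|e| -> ([set y in s] == e) = perm_eq s (enum e).
Proof.
move=> size_s; apply/eqP/idP => [eq_e|/perm_mem eq_e]; last first.
  by apply/setP => y; rewrite inE eq_e mem_enum.
have mem_s : s =i enum e by move=> y; rewrite mem_enum -eq_e in_set.
apply: uniq_perm; rewrite ?enum_uniq //.
by rewrite (eq_uniq _ mem_s) ?enum_uniq ?size_s ?cardE.
Qed.

Lemma dvdn_prod_fact_sum (I : Type) (r : seq I) (P : pred I) (F : I -> nat) :
  (\prod_(i <- r | P i) (F i)`! %| (\sum_(i <- r | P i) F i)`!)%N.
Proof.
elim/big_rec2: _ => // i a b _ dvd_ba.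
rewrite -(bin_fact (leq_addr a (F i))) addKn.
by rewrite dvdn_mull // dvdn_mul.
Qed.

Lemma sum_count_mem (K : finType) (s : seq K) :
  (\sum_l count_mem l s = size s)%N.
Proof.
rewrite -[RHS]sum1_size [RHS](partition_big id xpredT) //.
by apply: eq_bigr => l _; rewrite sum1_count.
Qed.

Lemma prod_fact_count_mem_cons (K : finType) (b : K) (s : seq K) :
  (\prod_l (count_mem l (b :: s))`! =
   count_mem b (b :: s) * \prod_l (count_mem l s)`!)%N.
Proof.
rewrite (bigD1 b) //= [in RHS](bigD1 b) //= eqxx mulnA -factS.
by congr (_ * _)%N; apply: eq_bigr => l /negPf; rewrite eq_sym => ->.
Qed.

Lemma multinomial_sum (k : nat) (m_ : 'I_k -> nat) :
  (multinomial (\sum_l m_ l) m_ * \prod_l (m_ l)`! = (\sum_l m_ l)`!)%N.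
Proof. exact/divnK/dvdn_prod_fact_sum. Qed.

Lemma multinomial_count_mem (k m : nat) (b : m.-tuple 'I_k) :
  (multinomial m (fun l => count_mem l b) * \prod_l (count_mem l b)`! = m`!)%N.
Proof.
have := multinomial_sum (fun l => count_mem l b).
by rewrite sum_count_mem size_tuple.
Qed.

Lemma multinomial_count_mem_gt0 (k m : nat) (b : m.-tuple 'I_k) :
  (0 < multinomial m (fun l => count_mem l b))%N.
Proof.
by have := fact_gt0 m; rewrite -(multinomial_count_mem b) muln_gt0 => /andP[].
Qed.

Section ArrangementsOver.
Variables (T : finType) (K : eqType) (f : T -> K).

Definition arrangements_over (m : nat) (s : seq T) (b : m.-tuple K) :
    {set m.-tuple T} :=
  [set t : m.-tuple T | perm_eq t s & map f t == b].

Lemma arrangements_over_eq0 (m : nat) (s : seq T) (b : m.-tuple K) :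
  ~~ perm_eq (map f s) b -> arrangements_over s b = set0.
Proof.
move=> /negP not_sb; apply/setP => t; rewrite !inE.
apply/negP => /andP[ts /eqP fb]; apply: not_sb.
by rewrite -fb perm_map // perm_sym.
Qed.

Lemma card_arrangements_over_cons (m : nat) (s : seq T) (b0 : K)
    (b : m.-tuple K) :
  #|arrangements_over s [tuple of b0 :: b]| =
  (\sum_(y in s | f y == b0) #|arrangements_over (rem y s) b|)%N.
Proof.
rewrite -sum1dep_card big_tuple_cons [RHS]big_mkcond /=.
apply: eq_bigr => y _; case: ifP => [/andP[ys /eqP fy]|not_y].
  rewrite -sum1dep_card; apply: eq_bigl => t.
  by rewrite (permPr (perm_to_rem ys)) perm_cons eqseq_cons fy eqxx.
apply: big_pred0 => t; apply: contraFF not_y => /andP[/perm_mem/(_ y)].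
by rewrite mem_head eqseq_cons => <- /andP[].
Qed.

End ArrangementsOver.

Lemma card_arrangements_over (T K : finType) (f : T -> K) (m : nat) (s : seq T)
    (b : m.-tuple K) :
  uniq s -> perm_eq (map f s) b ->
  #|arrangements_over f s b| = (\prod_l (count_mem l b)`!)%N.
Proof.
elim: m s b => [|m IHm] s b Us.
  rewrite (tuple0 b) => /perm_size/eqP; rewrite size_map => /nilP->.
  rewrite big1 // (_ : arrangements_over f _ _ = setT) ?cardsT ?card_tuple //.
  by apply/setP => t; rewrite !inE (tuple0 t).
case/tupleP: b => b0 b sb; rewrite card_arrangements_over_cons.
transitivity (\sum_(y in s | f y == b0) \prod_l (count_mem l b)`!)%N.
  apply: eq_bigr => y /andP[ys /eqP fy]; apply: IHm; first exact: rem_uniq.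
  rewrite -(perm_cons b0) -(permPr sb) -fy -map_cons.
  by rewrite perm_map // perm_sym perm_to_rem.
rewrite sum_nat_const prod_fact_count_mem_cons; congr (_ * _)%N.
rewrite -(permP sb) count_map -size_filter.
rewrite -(card_uniqP (filter_uniq _ Us)); apply: eq_card => y.
by rewrite mem_filter inE andbC.
Qed.

Section ArrayProduct.
Variables (R : pzSemiRingType) (d n p : nat) (d_gt0 : (0 < d)%N).

Lemma array_mulmxE (q : nat) (A : array R d n p) (M : 'M[R]_(p, q)) x b :
  array_mulmx d_gt0 A M (x, b) =
  \sum_(t : (d.-1).-tuple 'I_p)
     A (x, t) * \prod_(j < d.-1) M (tnth t j) (tnth b j).
Proof.
rewrite !ffunE /=; apply: eq_bigr => t _; congr (_ * _).
apply: eq_bigr => j _; rewrite ffunE /= /thead tnth_mktuple tcastE.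
by congr (M _ (tnth b _)); apply: val_inj; rewrite /= muln1 addn0.
Qed.

Lemma mx_mularrayE (q : nat) (M : 'M[R]_(n, p)) (S : array R d p q) x b :
  mx_mularray d_gt0 M S (x, b) = \sum_i M x i * S (i, b).
Proof.
rewrite !ffunE /= (reindex (fun i : 'I_p => [tuple i])) /=; last first.
  exists (fun t => thead t) => t _ //.
  by apply: val_inj; case: t => [[|a []]].
apply: eq_bigr => i _; rewrite ffunE big_ord1 /=; congr (_ * S (_, _)).
apply: eq_from_tnth => j; rewrite tnth_mktuple tcastE.
by congr (tnth b _); apply: val_inj.
Qed.

Lemma prod_color_mx (m k : nat) (f : 'I_p -> 'I_k) (t : m.-tuple 'I_p)
    (b : m.-tuple 'I_k) :
  \prod_(j < m) color_mx R f (tnth t j) (tnth b j) = (map f t == b)%:R.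
Proof.
have -> : (map f t == b) = \big[andb/true]_j (f (tnth t j) == tnth b j).
  rewrite big_andE -[LHS]/(map_tuple f t == b) eqEtuple.
  by apply: eq_forallb => j; rewrite tnth_map.
rewrite (big_morph nat_of_bool (fun b1 b2 => esym (mulnb b1 b2)) erefl).
by rewrite natr_prod; apply: eq_bigr => j _; rewrite mxE.
Qed.

Lemma array_mul_color_mx (k : nat) (A : array R d n p) (f : 'I_p -> 'I_k) x b :
  array_mulmx d_gt0 A (color_mx R f) (x, b) =
  \sum_(t : (d.-1).-tuple 'I_p | map f t == b) A (x, t).
Proof.
rewrite array_mulmxE [RHS]big_mkcond; apply: eq_bigr => t _.
by rewrite prod_color_mx mulr_natr mulrb.
Qed.

Lemma color_mx_mul_array (q : nat) (f : 'I_n -> 'I_p) (S : array R d p q) x b :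
  mx_mularray d_gt0 (color_mx R f) S (x, b) = S (f x, b).
Proof.
rewrite mx_mularrayE (bigD1 (f x)) //= mxE eqxx mul1r big1 ?addr0 // => i.
by rewrite mxE eq_sym => /negPf->; rewrite mul0r.
Qed.

End ArrayProduct.

Section RangeDegree.
Variables (d n k : nat) (G : uhypergraph d n) (f : 'I_n -> 'I_k).

Definition colored_completions (x : 'I_n) (b : (d.-1).-tuple 'I_k) :
    {set (d.-1).-tuple 'I_n} :=
  [set t : (d.-1).-tuple 'I_n |
     [set y in x :: t] \in hyperedges G & map f t == b].

Lemma color_range_rem (x : 'I_n) (e : {set 'I_n}) :
  x \in e -> color_range f e = seq_mset (f x :: map f (rem x (enum e))).
Proof.
move=> xe; apply/eq_seq_msetP.
by rewrite -map_cons perm_map // perm_to_rem // mem_enum.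
Qed.

Lemma size_rem_hyperedge (x : 'I_n) (e : {set 'I_n}) :
  e \in hyperedges G -> x \in e -> size (rem x (enum e)) = d.-1.
Proof.
by move=> eG xe; rewrite size_rem ?mem_enum // -cardE (hyperedges_uniform eG).
Qed.

Lemma completions_of_hyperedge (x : 'I_n) (e : {set 'I_n})
    (b : (d.-1).-tuple 'I_k) :
  e \in hyperedges G -> x \in e ->
  [set t in colored_completions x b | [set y in x :: t] == e] =
  arrangements_over f (rem x (enum e)) b.
Proof.
move=> eG xe; have xe' : x \in enum e by rewrite mem_enum.
apply/setP => t; rewrite !inE -(perm_cons x) -(permPr (perm_to_rem xe')).
rewrite -eq_set_seq_perm_enum.
  by case: (_ =P e) => [->|_]; rewrite ?eG ?andbT ?andbF.
rewrite cardE (perm_size (perm_to_rem xe')) /=.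
by rewrite size_rem_hyperedge ?size_tuple.
Qed.

Lemma card_completions_of_hyperedge (x : 'I_n) (e : {set 'I_n})
    (b : (d.-1).-tuple 'I_k) :
  e \in hyperedges G -> x \in e ->
  #|[set t in colored_completions x b | [set y in x :: t] == e]| =
  ((color_range f e == seq_mset (f x :: b)) *
   \prod_(l < k) (count_mem l b)`!)%N.
Proof.
move=> eG xe; rewrite completions_of_hyperedge // (color_range_rem xe).
rewrite -(sameP (eq_seq_msetP _ _) eqP) perm_cons.
case: (boolP (perm_eq _ _)) => [eb|/arrangements_over_eq0->]; last first.
  by rewrite cards0.
by rewrite mul1n card_arrangements_over ?rem_uniq ?enum_uniq.
Qed.

Lemma card_colored_completions (x : 'I_n) (b : (d.-1).-tuple 'I_k) :
  #|colored_completions x b| =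
  (range_degree G f x (seq_mset (f x :: b)) *
   \prod_(l < k) (count_mem l b)`!)%N.
Proof.
rewrite -sum1_card.
rewrite (partition_big (fun t : (d.-1).-tuple 'I_n => [set y in x :: t])
  (fun e => (e \in hyperedges G) && (x \in e))) /=; last first.
  by move=> t; rewrite inE => /andP[-> _]; rewrite inE mem_head.
transitivity (\sum_(e in hyperedges G | x \in e)
    (color_range f e == seq_mset (f x :: b)) *
    \prod_(l < k) (count_mem l b)`!)%N.
  apply: eq_bigr => e /andP[eG xe].
  by rewrite -card_completions_of_hyperedge // sum1dep_card.
rewrite -big_distrl /range_degree -sum1dep_card /=; congr (_ * _)%N.
by rewrite -big_mkcondr; apply: eq_bigl => e; rewrite andbA.
Qed.

Lemma range_degree_gt0_cons (x : 'I_n) (gamma : {mset 'I_k}%mset) :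
  (0 < range_degree G f x gamma)%N ->
  exists b : (d.-1).-tuple 'I_k, gamma = seq_mset (f x :: b).
Proof.
case/card_gt0P => e; rewrite inE => /and3P[eG xe /eqP <-].
have size_colors : size (map f (rem x (enum e))) == d.-1.
  by rewrite size_map size_rem_hyperedge.
by exists (Tuple size_colors); apply: color_range_rem.
Qed.

Lemma eq_range_degree (x y : 'I_n) :
  f x = f y ->
  (forall b : (d.-1).-tuple 'I_k,
     range_degree G f x (seq_mset (f x :: b)) =
     range_degree G f y (seq_mset (f x :: b))) ->
  range_degree G f x =1 range_degree G f y.
Proof.
move=> fxy eq_deg gamma; have [dx0|] := posnP (range_degree G f x gamma).
  have [dy0|] := posnP (range_degree G f y gamma); first by rewrite dx0.
  by case/range_degree_gt0_cons => b ->; rewrite -fxy.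
by case/range_degree_gt0_cons => b ->.
Qed.

Variable R : numFieldType.

Definition normalized_degree (x : 'I_n) (b : (d.-1).-tuple 'I_k) : R :=
  (range_degree G f x (seq_mset (f x :: b)))%:R
  / (multinomial d.-1 (fun l => count_mem l b))%:R.

Lemma normalized_degree_card (x : 'I_n) (b : (d.-1).-tuple 'I_k) :
  normalized_degree x b = #|colored_completions x b|%:R / (d.-1)`!%:R.
Proof.
have prod_neq0 : (\prod_(l < k) (count_mem l b)`!)%:R != 0 :> R.
  by rewrite pnatr_eq0 -lt0n prodn_gt0 // => l; apply: fact_gt0.
rewrite card_colored_completions -(multinomial_count_mem b) !natrM -mulf_div.
by rewrite divff // mulr1.
Qed.

Lemma perfect_normalized_degree :
  perfect G f <->
  forall x y, f x = f y -> normalized_degree x =1 normalized_degree y.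
Proof.
split=> [f_perf x y fxy b | eq_deg i gamma x y <- fyx].
  by rewrite /normalized_degree fxy (f_perf (f y) _ x y).
apply: eq_range_degree => // b.
have multinomial_neq0 : (multinomial d.-1 (fun l => count_mem l b))%:R
    != 0 :> R.
  by rewrite pnatr_eq0 -lt0n multinomial_count_mem_gt0.
have /(divIf multinomial_neq0)/eqP := eq_deg x y (esym fyx) b.
by rewrite eqr_nat fyx => /eqP.
Qed.

Variable d_gt0 : (0 < d)%N.

Lemma adjacency_mul_color_mx (x : 'I_n) (b : (d.-1).-tuple 'I_k) :
  array_mulmx d_gt0 (adjacency R G) (color_mx R f) (x, b) =
  normalized_degree x b.
Proof.
rewrite array_mul_color_mx normalized_degree_card mulr_natl -sumr_const.
rewrite [RHS]big_mkcond [LHS]big_mkcond; apply: eq_bigr => t _.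
by rewrite ffunE !inE andbC; case: (map f t == b).
Qed.

Lemma adjacency_mul_color_mx_eqP (S : array R d k k) :
  array_mulmx d_gt0 (adjacency R G) (color_mx R f) =
    mx_mularray d_gt0 (color_mx R f) S
  <-> forall x b, S (f x, b) = normalized_degree x b.
Proof.
split=> [AP_PS x b | defS].
  by rewrite -adjacency_mul_color_mx AP_PS color_mx_mul_array.
by apply/ffunP=> -[x b]; rewrite adjacency_mul_color_mx color_mx_mul_array.
Qed.

End RangeDegree.

Theorem theorem5 (R : numFieldType) (d n k : nat) (d_gt0 : (0 < d)%N)
    (G : uhypergraph d n) (f : 'I_n -> 'I_k) (f_col : coloring f) :
  (perfect G f <->
     exists S : array R d k k,
       array_mulmx d_gt0 (adjacency R G) (color_mx R f)
         = mx_mularray d_gt0 (color_mx R f) S)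
  /\
  (forall S : array R d k k,
     array_mulmx d_gt0 (adjacency R G) (color_mx R f)
       = mx_mularray d_gt0 (color_mx R f) S ->
     forall (gamma1 : 'I_k) (gamma' : (d.-1).-tuple 'I_k) (x : 'I_n),
       f x = gamma1 ->
       S (gamma1, gamma')
         = (range_degree G f x (seq_mset (gamma1 :: gamma')))%:R
           * ((multinomial d.-1 (fun l : 'I_k => count_mem l gamma'))%:R)^-1).
Proof.
split; last first.
  by move=> S /adjacency_mul_color_mx_eqP S_degree _ b x <-; apply: S_degree.
rewrite (perfect_normalized_degree G f R); split=> [eq_deg | [S]]; last first.
  move=> /adjacency_mul_color_mx_eqP S_degree x y fxy b.
  by rewrite -!S_degree fxy.
have [g fgK] := fin_all_exists f_col.
exists [ffun c => normalized_degree G f R (g c.1) c.2].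
by apply/adjacency_mul_color_mx_eqP => x b; rewrite ffunE; apply: eq_deg.
Qed.
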